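(* Let $\Omega\subseteq\mathbb{R}^n$ be closed and convex and let $f:\Omega\to\mathbb{R}$ be continuously differentiable. Assume that $f$ is convex on $\Omega$ and that the solution set $X^*$ of the problem $\min_{x\in\Omega} f(x)$ is not empty. Let $\{x^{(k)}\}_{k\in\mathbb{N}}$ be a sequence generated by the scaled gradient projection (SGP) method (described in the context), where $D_k\in\mathcal{M}_{\mu_k}$ for all $k$ and $\{\mu_k\}_{k\in\mathbb{N}}$ satisfies $$\mu_k^2 = 1+\zeta_k,\qquad \zeta_k\geq 0,\qquad \sum_{k=0}^\infty \zeta_k<\infty .$$ Assume in addition that one of the following holds: (a) $\nabla f$ is globally Lipschitz on $\Omega$; (b) $\nabla f$ is locally Lipschitz and $f$ is level bounded on $\Omega$. Let $f^*$ be the optimal function value of $\min_{x\in\Omega} f(x)$. Then $$f(x^{(k)})-f^*=\mathcal{O}(1/k).$$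
   Context: Notation: $\|\cdot\|$ is the Euclidean norm; for a symmetric positive definite matrix $D$, $\|x\|_D=(x^TDx)^{1/2}$. For $\mu\geq 1$, $\mathcal{M}_\mu$ denotes the set of symmetric positive definite $n\times n$ matrices with all eigenvalues in $[1/\mu,\mu]$. A continuously differentiable $f:\Omega\to\mathbb{R}$ is convex if $f(y)\geq f(x)+\nabla f(x)^T(y-x)$ for all $x,y\in\Omega$. A map $F$ on $\Omega$ is globally Lipschitz if there is $L$ with $\|F(y)-F(x)\|\leq L\|y-x\|$ for all $x,y\in\Omega$; it is locally Lipschitz if for every compact $K\subseteq\Omega$ there is $L_K>0$ with $\|F(y)-F(x)\|\leq L_K\|y-x\|$ for all $x,y\in K$. The function $f$ is level bounded on $\Omega$ if $\{x\in\Omega: f(x)\leq\zeta\}$ is bounded for every $\zeta\in\mathbb{R}$. Armijo linesearch: given parameters $\delta,\beta\in(0,1)$, a point $x^{(k)}\in\Omega$ and a direction $d^{(k)}$, start with $\lambda^{(k)}=1$ and, as long as the inequality $$f(x^{(k)}+\lambda^{(k)}d^{(k)})\leq f(x^{(k)})+\beta\lambda^{(k)}\nabla f(x^{(k)})^Td^{(k)}$$ is not satisfied, replace $\lambda^{(k)}$ by $\delta\lambda^{(k)}$; the output is the first $\lambda^{(k)}$ satisfying it. SGP method: choose $0<\alpha_{\min}\leq\alpha_{\max}$, $\mu\geq 1$, $\delta,\beta\in(0,1)$, $x^{(0)}\in\Omega$. For $k=0,1,2,\dots$: 1. choose $\alpha_k\in[\alpha_{\min},\alpha_{\max}]$; 2.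 choose $\mu_k\leq\mu$ (with $\mu_k\ge 1$) and a matrix $D_k\in\mathcal{M}_{\mu_k}$; 3. compute $y^{(k)}$, the projection onto $\Omega$ of $x^{(k)}-\alpha_kD_k\nabla f(x^{(k)})$ in the norm $\|\cdot\|_{D_k^{-1}}$, i.e. $$y^{(k)}=\arg\min_{x\in\Omega}\ \nabla f(x^{(k)})^T(x-x^{(k)})+\frac{1}{2\alpha_k}(x-x^{(k)})^TD_k^{-1}(x-x^{(k)});$$ 4. set $d^{(k)}=y^{(k)}-x^{(k)}$; 5. compute $\lambda^{(k)}$ with the Armijo linesearch (parameters $\delta,\beta$); 6. set $x^{(k+1)}=x^{(k)}+\lambda^{(k)}d^{(k)}$. *)

(* Defs.v *)
From HB Require Import structures.
From mathcomp Require Import all_boot all_order all_algebra.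
From mathcomp Require Import all_classical all_reals all_analysis.

Set Implicit Arguments.
Unset Strict Implicit.
Unset Printing Implicit Defensive.

Import Order.TTheory GRing.Theory Num.Theory.
Import numFieldNormedType.Exports.

Local Open Scope classical_set_scope.
Local Open Scope ring_scope.

(* The norm `|x| that the library puts on 'cV[R]_n is the sup norm; it induces
   the same topology and the same bounded sets as [enorm], but the Lipschitz
   conditions below are stated with the Euclidean norm. *)
Definition dotv (R : realType) (n : nat) (u v : 'cV[R]_n) : R :=
  (u^T *m v) 0 0.

Definition enorm (R : realType) (n : nat) (v : 'cV[R]_n) : R :=
  Num.sqrt (dotv v v).

Definition spd (R : realType) (n : nat) (D : 'M[R]_n) : Prop :=
  D^T = D /\ forall v : 'cV[R]_n, v != 0 -> 0 < dotv v (D *m v).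

Definition scaling_mx (R : realType) (n : nat) (mu : R) : set 'M[R]_n :=
  [set D | spd D /\ forall a : R, eigenvalue D a -> mu^-1 <= a <= mu].

(* Only the values of [f] and [g] on [Omega] matter: the Frechet derivative is
   taken along points of [Omega], so that [f : Omega -> R] needs no extension.
   When [f] is C^1 on an open neighbourhood of [Omega], its usual gradient is
   such a [g]; when [Omega] has empty interior, [g] need not be unique. *)
Definition C1_on (R : realType) (n : nat) (Omega : set 'cV[R]_n)
    (f : 'cV[R]_n -> R) (g : 'cV[R]_n -> 'cV[R]_n) : Prop :=
  (forall x, Omega x ->
    (f y - f x - dotv (g x) (y - x)) / enorm (y - x)
      @[y --> within Omega x^'] --> (0 : R)) /\
  {within Omega, continuous g}.

Definition convex_on (R : realType) (n : nat) (Omega : set 'cV[R]_n)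
    (f : 'cV[R]_n -> R) (g : 'cV[R]_n -> 'cV[R]_n) : Prop :=
  forall x y, Omega x -> Omega y -> f x + dotv (g x) (y - x) <= f y.

Definition globally_lipschitz (R : realType) (n : nat) (Omega : set 'cV[R]_n)
    (F : 'cV[R]_n -> 'cV[R]_n) : Prop :=
  exists L : R, forall x y, Omega x -> Omega y ->
    enorm (F y - F x) <= L * enorm (y - x).

Definition locally_lipschitz (R : realType) (n : nat) (Omega : set 'cV[R]_n)
    (F : 'cV[R]_n -> 'cV[R]_n) : Prop :=
  forall K : set 'cV[R]_n, compact K -> K `<=` Omega ->
  exists L : R, 0 < L /\ forall x y, K x -> K y ->
    enorm (F y - F x) <= L * enorm (y - x).

Definition level_bounded (R : realType) (n : nat) (Omega : set 'cV[R]_n)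
    (f : 'cV[R]_n -> R) : Prop :=
  forall z : R, bounded_set [set x | Omega x /\ f x <= z].

Definition argmin_on (R : realType) (n : nat) (Omega : set 'cV[R]_n)
    (h : 'cV[R]_n -> R) : set 'cV[R]_n :=
  [set x | Omega x /\ forall z, Omega z -> h x <= h z].

(* The infimum is a minimum whenever [argmin_on Omega f] is nonempty. *)
Definition optimal_value (R : realType) (n : nat) (Omega : set 'cV[R]_n)
    (f : 'cV[R]_n -> R) : R := inf (f @` Omega).

Definition armijo_cond (R : realType) (n : nat) (f : 'cV[R]_n -> R)
    (g : 'cV[R]_n -> 'cV[R]_n) (beta : R) (x d : 'cV[R]_n) (l : R) : Prop :=
  f (x + l *: d) <= f x + beta * l * dotv (g x) d.

Definition armijo_step (R : realType) (n : nat) (f : 'cV[R]_n -> R)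
    (g : 'cV[R]_n -> 'cV[R]_n) (delta beta : R) (x d : 'cV[R]_n) (l : R)
    : Prop :=
  exists m : nat, [/\ l = delta ^+ m,
    armijo_cond f g beta x d (delta ^+ m) &
    forall j, (j < m)%N -> ~ armijo_cond f g beta x d (delta ^+ j)].

(* Up to a term independent of [z], this is
   ||z - (x - alpha D grad f(x))||^2 / (2 alpha) in the norm of D^-1. *)
Definition sgp_model (R : realType) (n : nat) (g : 'cV[R]_n -> 'cV[R]_n)
    (alpha : R) (D : 'M[R]_n) (x z : 'cV[R]_n) : R :=
  dotv (g x) (z - x) + (2 * alpha)^-1 * dotv (z - x) (invmx D *m (z - x)).

Record sgp (R : realType) (n : nat) (Omega : set 'cV[R]_n)
    (f : 'cV[R]_n -> R) (g : 'cV[R]_n -> 'cV[R]_n)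
    (alpha_min alpha_max mu delta beta : R)
    (alpha mu_ : nat -> R) (D : nat -> 'M[R]_n)
    (x y d : nat -> 'cV[R]_n) (lambda : nat -> R) : Prop := Sgp {
  sgp_alpha_bounds : 0 < alpha_min <= alpha_max ;
  sgp_mu : 1 <= mu ;
  sgp_delta : 0 < delta < 1 ;
  sgp_beta : 0 < beta < 1 ;
  sgp_x0 : Omega (x 0%N) ;
  sgp_alpha : forall k, alpha_min <= alpha k <= alpha_max ;
  sgp_mu_ : forall k, 1 <= mu_ k <= mu ;
  sgp_D : forall k, scaling_mx (mu_ k) (D k) ;
  sgp_y : forall k, argmin_on Omega (sgp_model g (alpha k) (D k) (x k)) (y k) ;
  sgp_d : forall k, d k = y k - x k ;
  sgp_lambda : forall k, armijo_step f g delta beta (x k) (d k) (lambda k) ;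
  sgp_next : forall k, x k.+1 = x k + lambda k *: d k }.

(* Main.v *)
(* Optimality of y^(k) gives |d|^2 <= mu alpha_max (- grad f . d), so the Lipschitz
   bound makes the linesearch stop at steps bounded away from 0. Expanding
   |x^(k+1) - x^*|^2 in the norm of D_k^-1 and using the variational inequality of
   the projection, convexity and the Armijo inequality yields, for
   e_k = f(x^(k)) - f^* and suitable constants A, c > 0,
     V_(k+1) + c e_k <= (1 + zeta_k) V_k   with   V_k = |x^(k) - x^*|^2 + A e_k.
   Summability of zeta makes V bounded and then e summable; as e is nonincreasing,
   k e_k is at most its sum. *)
Require Import Defs.
From HB Require Import structures.
From mathcomp Require Import all_boot all_order all_algebra.
From mathcomp Require Import all_classical all_reals all_analysis.
From mathcomp Require Import lra.

Set Implicit Arguments.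
Unset Strict Implicit.
Unset Printing Implicit Defensive.

Import Order.TTheory GRing.Theory Num.Theory.
Import numFieldNormedType.Exports.

Local Open Scope classical_set_scope.
Local Open Scope ring_scope.

(** For small t the linear term dominates. This extracts the first-order condition from minimality
    along a segment. *)
Lemma ge0_of_quadratic (R : realType) (p q : R) :
  (forall t, 0 <= t <= 1 -> 0 <= t * p + t ^+ 2 * q) -> 0 <= p.
Proof.
move=> pq; rewrite leNgt; apply/negP => p0.
have q0 := normr_ge0 q; have qq := ler_norm q.
have c0 : 0 < `|q| - p by lra.
(* When p < 0, this [t] lies in (0, 1] and gives p + t q <= p + t |q| = t p < 0. *)
pose t := - p / (`|q| - p).
have tE : t * (`|q| - p) = - p by rewrite divfK// gt_eqF.
have t0 : 0 < t by rewrite divr_gt0//; lra.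
have t1 : t <= 1 by rewrite ler_pdivrMr//; lra.
have := pq t; rewrite (ltW t0) t1 => /(_ isT).
rewrite expr2 -mulrA -mulrDr pmulr_rge0//; nra.
Qed.

(** * Euclidean inner product and norm *)

Lemma dotvE (R : realType) (n : nat) (u v : 'cV[R]_n) :
  dotv u v = \sum_i u i 0 * v i 0.
Proof. by rewrite /dotv mxE; apply: eq_bigr => i _; rewrite mxE. Qed.

Lemma dotvC (R : realType) (n : nat) (u v : 'cV[R]_n) : dotv u v = dotv v u.
Proof. by rewrite !dotvE; apply: eq_bigr => i _; rewrite mulrC. Qed.

Lemma dotvDr (R : realType) (n : nat) (u v w : 'cV[R]_n) :
  dotv u (v + w) = dotv u v + dotv u w.
Proof. by rewrite /dotv mulmxDr mxE. Qed.

Lemma dotvDl (R : realType) (n : nat) (u v w : 'cV[R]_n) :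
  dotv (u + v) w = dotv u w + dotv v w.
Proof. by rewrite dotvC dotvDr !(dotvC w). Qed.

Lemma dotvZr (R : realType) (n : nat) (u v : 'cV[R]_n) (t : R) :
  dotv u (t *: v) = t * dotv u v.
Proof. by rewrite /dotv -scalemxAr mxE. Qed.

Lemma dotvZl (R : realType) (n : nat) (u v : 'cV[R]_n) (t : R) :
  dotv (t *: u) v = t * dotv u v.
Proof. by rewrite dotvC dotvZr dotvC. Qed.

Lemma dotvNr (R : realType) (n : nat) (u v : 'cV[R]_n) :
  dotv u (- v) = - dotv u v.
Proof. by rewrite -scaleN1r dotvZr mulN1r. Qed.

Lemma dotv0 (R : realType) (n : nat) (u : 'cV[R]_n) : dotv u 0 = 0.
Proof. by rewrite -(scale0r 0) dotvZr mul0r. Qed.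

Lemma dotvNl (R : realType) (n : nat) (u v : 'cV[R]_n) :
  dotv (- u) v = - dotv u v.
Proof. by rewrite dotvC dotvNr dotvC. Qed.

Definition dotv_lin := (dotvDr, dotvDl, dotvNr, dotvNl, dotvZr, dotvZl).

Lemma dotv_mulmx (R : realType) (n : nat) (S : 'M[R]_n) (u v : 'cV[R]_n) :
  dotv u (S *m v) = dotv (S^T *m u) v.
Proof. by rewrite /dotv trmx_mul trmxK mulmxA. Qed.

Lemma dotv_sym (R : realType) (n : nat) (S : 'M[R]_n) (u v : 'cV[R]_n) :
  S^T = S -> dotv u (S *m v) = dotv v (S *m u).
Proof. by move=> SE; rewrite dotv_mulmx SE dotvC. Qed.

Lemma dotvv_ge0 (R : realType) (n : nat) (v : 'cV[R]_n) : 0 <= dotv v v.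
Proof. by rewrite dotvE sumr_ge0// => i _; rewrite -expr2 sqr_ge0. Qed.

Lemma dotvv_coord (R : realType) (n : nat) (v : 'cV[R]_n) i :
  v i 0 ^+ 2 <= dotv v v.
Proof.
rewrite dotvE (bigD1 i)//= -expr2 lerDl sumr_ge0// => j _.
by rewrite -expr2 sqr_ge0.
Qed.

Lemma dotvv_eq0 (R : realType) (n : nat) (v : 'cV[R]_n) :
  (dotv v v == 0) = (v == 0).
Proof.
apply/eqP/eqP => [v0|->]; last exact: dotv0.
apply/colP => i; rewrite mxE; apply/eqP; rewrite -sqrf_eq0 eq_le sqr_ge0 andbT.
by rewrite -v0 dotvv_coord.
Qed.

Lemma sqr_enorm (R : realType) (n : nat) (v : 'cV[R]_n) :
  enorm v ^+ 2 = dotv v v.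
Proof. by rewrite sqr_sqrtr// dotvv_ge0. Qed.

Lemma enorm_ge0 (R : realType) (n : nat) (v : 'cV[R]_n) : 0 <= enorm v.
Proof. exact: sqrtr_ge0. Qed.

Lemma cauchy_schwarz (R : realType) (n : nat) (u v : 'cV[R]_n) :
  dotv u v <= enorm u * enorm v.
Proof.
apply: le_trans (ler_norm _) _.
rewrite -(@ler_pXn2r _ 2)// ?nnegrE ?mulr_ge0 ?enorm_ge0//.
rewrite exprMn !sqr_enorm -normrX ger0_norm ?sqr_ge0//.
have [/eqP|v0] := eqVneq (dotv v v) 0.
  by rewrite dotvv_eq0 => /eqP->; rewrite !dotv0 expr0n mulr0.
have vv : 0 < dotv v v by rewrite lt_neqAle eq_sym v0 dotvv_ge0.
rewrite -(ler_pM2l vv).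
(* This square expands to |v|^2 (|u|^2 |v|^2 - (u.v)^2). *)
have := dotvv_ge0 (dotv v v *: u - dotv u v *: v).
rewrite !dotv_lin (dotvC v u); nra.
Qed.

Lemma coord_le_enorm (R : realType) (n : nat) (v : 'cV[R]_n) i :
  `|v i 0| <= enorm v.
Proof.
rewrite -(@ler_pXn2r _ 2)// ?nnegrE ?enorm_ge0//.
by rewrite -normrX ger0_norm ?sqr_ge0// sqr_enorm dotvv_coord.
Qed.

(** The sharp factor is sqrt n; the cruder n is enough for boundedness arguments. *)
Lemma enorm_le_coord (R : realType) (n : nat) (v : 'cV[R]_n) (M : R) :
  0 <= M -> (forall i, `|v i 0| <= M) -> enorm v <= n%:R * M.
Proof.
move=> M0 vM; rewrite -(@ler_pXn2r _ 2)// ?nnegrE ?enorm_ge0 ?mulr_ge0//.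
rewrite sqr_enorm dotvE.
apply: (@le_trans _ _ (\sum_(i < n) M ^+ 2)).
  apply: ler_sum => i _; rewrite -expr2 -[leLHS]ger0_norm ?sqr_ge0// normrX.
  by rewrite ler_pXn2r// ?nnegrE.
rewrite sumr_const card_ord -[leLHS]mulr_natl exprMn ler_wpM2r ?sqr_ge0//.
by rewrite -natrX ler_nat -[leqLHS]expn1; case: (n) => // p; rewrite leq_pexp2l.
Qed.

(** * Compactness, Rayleigh quotients and bounds on the inverse scaling matrices *)

Lemma cV_compact (R : realType) (n : nat) (M : R) :
  compact [set v : 'cV[R]_n | forall i, `|v i 0| <= M].
Proof.
(* Boxes of row vectors are compact as products of segments; transposition is continuous and carries
   this to columns. *)
have -> : [set v : 'cV[R]_n | forall i, `|v i 0| <= M] =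
    trmx @` [set v : 'rV[R]_n | forall i, v 0 i \in `[- M, M]].
  apply/seteqP; split => [v vM|_ [v vM <-] i].
    exists v^T; last by rewrite trmxK.
    by move=> i; rewrite mxE in_itv/= -ler_norml.
  by rewrite mxE ler_norml; have := vM i; rewrite in_itv.
apply: continuous_compact; last first.
  apply: (@rV_compact _ _ (fun=> `[(- M), M]%classic)) => _.
  exact: segment_compact.
apply: continuous_subspaceT => /= v s /= /(nbhs_ballP v^T) [e e0 es].
apply/nbhs_ballP; exists e => //= w [_ vw]; apply: es.
by split => // i j; rewrite !mxE.
Qed.

Lemma continuous_dotv_mulmx (R : realType) (n : nat) (S : 'M[R]_n) :
  continuous (fun v : 'cV[R]_n => dotv v (S *m v)).
Proof.
have -> : (fun v : 'cV[R]_n => dotv v (S *m v)) =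
    (fun v => \sum_i v i 0 * \sum_j S i j * v j 0).
  by apply/funext => v; rewrite dotvE; apply: eq_bigr => i _; rewrite mxE.
apply: continuous_big => [|i _ v]; first exact: add_continuous.
apply: continuousM; first exact: coord_continuous.
apply: continuous_big => [|j _ w]; first exact: add_continuous.
by apply: continuousM; [exact: cst_continuous|exact: coord_continuous].
Qed.

(* The minimum of the Rayleigh quotient is attained on the unit sphere, and its
   value is an eigenvalue. *)
Lemma rayleigh_ge (R : realType) (n : nat) (S : 'M[R]_n) (m : R) :
  S^T = S -> (forall a, eigenvalue S a -> m <= a) ->
  forall v, m * dotv v v <= dotv v (S *m v).
Proof.
move=> SE mS v.
have [->|v0] := eqVneq v 0.
  by rewrite mulmx0 !dotv0 mulr0.
have normalize (w : 'cV[R]_n) : w != 0 ->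
    dotv ((enorm w)^-1 *: w) ((enorm w)^-1 *: w) = 1.
  move=> w0; rewrite !dotv_lin mulrA -expr2 -sqr_enorm -exprMn mulVf ?expr1n//.
  by rewrite -sqrf_eq0 sqr_enorm dotvv_eq0.
pose A := [set w : 'cV[R]_n | dotv w w = 1].
have cA : compact A.
  apply: (subclosed_compact _ (@cV_compact R n 1)) => [|w w1 i].
    have -> : A = (fun w => dotv w (1%:M *m w)) @^-1` [set 1].
      by apply/seteqP; split => w; rewrite /A /= mul1mx.
    by apply: closed_comp => [w _|]; [exact: continuous_dotv_mulmx|exact: closed_eq].
  by rewrite (le_trans (coord_le_enorm _ _))// /enorm w1 sqrtr1.
have [|u uA umin] := compact_EVT_min _ cA
    (continuous_subspaceT (@continuous_dotv_mulmx R n S)).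
  by exists ((enorm v)^-1 *: v); exact: normalize.
have u1 : dotv u u = 1 by move: uA; rewrite inE.
pose a := dotv u (S *m u).
have ageq w : a * dotv w w <= dotv w (S *m w).
  have [->|w0] := eqVneq w 0.
    by rewrite mulmx0 !dotv0 mulr0.
  have := umin ((enorm w)^-1 *: w); rewrite inE => /(_ (normalize _ w0)).
  have ww : 0 < dotv w w by rewrite lt_neqAle eq_sym dotvv_eq0 w0 dotvv_ge0.
  rewrite -scalemxAr !dotv_lin mulrA -expr2 exprVn sqr_enorm -/a mulrC.
  by rewrite ler_pdivlMr.
(* Let r be the residual S u - a u. Applying [ageq] to u - t r, with equality at t = 0, leaves a
   quadratic in t whose linear coefficient is -2 r.r; it must be nonnegative, so r = 0. *)
have Su : S *m u = a *: u.
  apply/eqP; rewrite -subr_eq0 -dotvv_eq0; set r := S *m u - _.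
  have rr : dotv r r = dotv r (S *m u) - a * dotv r u 
    by rewrite {2}/r dotvDr dotvNr dotvZr.
  move: rr; clearbody r => rr.
  pose q := dotv r (S *m r) - a * dotv r r.
  suff : 0 <= - 2 * dotv r r.
    by rewrite mulNr oppr_ge0 pmulr_rle0// eq_le dotvv_ge0 andbT.
  apply: (@ge0_of_quadratic _ _ q) => t _.
  have := ageq (u - t *: r); rewrite mulmxDr mulmxN -scalemxAr !dotv_lin -/a u1.
  rewrite (dotv_sym u r SE) (dotvC u r) {1}rr /q; nra.
apply: le_trans (ageq v); rewrite ler_wpM2r ?dotvv_ge0//; apply: mS.
apply/eigenvalueP; exists u^T; first by rewrite -{1}SE -trmx_mul Su linearZ.
apply/eqP => /(congr1 trmx); rewrite trmxK trmx0 => u0.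
by move/eqP: u1; rewrite u0 dotv0 eq_sym oner_eq0.
Qed.

Lemma scaling_mx_unit (R : realType) (n : nat) (mu : R) (D : 'M[R]_n) :
  0 < mu -> scaling_mx mu D -> D \in unitmx.
Proof.
move=> mu0 [_ Dmu]; rewrite -row_free_unit -kermx_eq0.
apply/negPn/negP => D0; have : eigenvalue D 0.
  by rewrite /eigenvalue /eigenspace raddf0 subr0.
by move/Dmu; rewrite leNgt invr_gt0 mu0.
Qed.

(** The interval [1/mu, mu] is stable under inversion, so it also contains the eigenvalues of D^-1.
    The two bounds are [rayleigh_ge] for D^-1 and for its opposite. *)
Lemma scaling_mx_invmx (R : realType) (n : nat) (mu : R) (D : 'M[R]_n) :
  0 < mu -> scaling_mx mu D ->
  (invmx D)^T = invmx D /\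
  forall v, mu^-1 * dotv v v <= dotv v (invmx D *m v) <= mu * dotv v v.
Proof.
move=> mu0 Dmu; have Du := scaling_mx_unit mu0 Dmu.
have ST : (invmx D)^T = invmx D by rewrite trmx_inv Dmu.1.1.
have eig a : eigenvalue (invmx D) a -> mu^-1 <= a <= mu.
  move=> /eigenvalueP [u uD u0].
  have uaD : u = a *: (u *m D) by rewrite scalemxAl -uD mulmxKV.
  have a0 : a != 0 by apply: contra_neq u0 => a0; rewrite uaD a0 scale0r.
  have /andP[ma am] : mu^-1 <= a^-1 <= mu.
    apply: Dmu.2; apply/eigenvalueP; exists u => //.
    by rewrite {2}uaD scalerA mulVf// scale1r.
  have a_gt0 : 0 < a by rewrite -invr_gt0 (lt_le_trans _ ma)// invr_gt0.
  rewrite -(invrK a) lef_pV2 ?posrE ?invr_gt0// am /=.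
  by rewrite -[leRHS]invrK lef_pV2 ?posrE ?invr_gt0.
split=> // v; apply/andP; split.
  by apply: rayleigh_ge => // a /eig /andP[].
rewrite -lerN2 -mulNr -dotvNr -mulNmx; apply: rayleigh_ge => [|a].
  by rewrite linearN/= ST.
move=> /eigenvalueP [u uD u0]; rewrite lerNl.
have /eig/andP[] // : eigenvalue (invmx D) (- a).
by apply/eigenvalueP; exists u => //; rewrite scaleNr -uD mulmxN opprK.
Qed.

(** * Segments, projection, descent and linesearch for a single step *)

Lemma convex_set_segment (R : realType) (n : nat) (Omega : set 'cV[R]_n) x y t :
  convex_set Omega -> Omega x -> Omega y -> 0 <= t <= 1 ->
  Omega (x + t *: (y - x)).
Proof.
move=> cO xO yO /andP[t0 t1].
have := cO y x (Itv01 t0 t1); rewrite !inE => /(_ yO xO).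
rewrite /conv/=; congr Omega.
by rewrite scalerBr scalerBl scale1r addrC -addrA [- _ + _]addrC addrA.
Qed.

(* The variational inequality characterizing the projection [y]. *)
Lemma sgp_model_argmin (R : realType) (n : nat) (Omega : set 'cV[R]_n)
    (g : 'cV[R]_n -> 'cV[R]_n) (a : R) (D : 'M[R]_n) (x y z : 'cV[R]_n) :
  convex_set Omega -> (invmx D)^T = invmx D ->
  argmin_on Omega (sgp_model g a D x) y -> Omega z ->
  0 <= dotv (g x) (z - y) + a^-1 * dotv (z - y) (invmx D *m (y - x)).
Proof.
move=> cO ST [yO ymin] zO.
apply: (@ge0_of_quadratic _ _ ((2 * a)^-1 * dotv (z - y) (invmx D *m (z - y)))).
move=> t t01.
have := ymin _ (convex_set_segment cO yO zO t01).
rewrite /sgp_model (addrAC y) -subr_ge0.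
move: (z - y) (y - x) => w v.
rewrite mulmxDr -scalemxAr !dotv_lin (dotv_sym v w ST) invfM.
by move: (a^-1) => b; lra.
Qed.

(** Convexity at the new point z gives f(z) <= f(x) + t g(z).d, and Cauchy-Schwarz controls g(z) -
    g(x). Integration along the segment would give L/2 instead of L, but here the Lipschitz bound is
    used only between the two endpoints. *)
Lemma convex_on_descent (R : realType) (n : nat) (Omega : set 'cV[R]_n)
    (f : 'cV[R]_n -> R) (g : 'cV[R]_n -> 'cV[R]_n) (L t : R) (x d : 'cV[R]_n) :
  convex_on Omega f g -> Omega x -> Omega (x + t *: d) -> 0 <= t ->
  enorm (g (x + t *: d) - g x) <= L * enorm (t *: d) ->
  f (x + t *: d) <= f x + t * dotv (g x) d + L * t ^+ 2 * dotv d d.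
Proof.
move=> cf xO zO t0; set z := x + t *: d => Lip.
have := cf z x zO xO; rewrite -[x - z]opprB addrC -/z.
have -> : z - x = t *: d by rewrite /z addrC addKr.
have := cauchy_schwarz (g z - g x) (t *: d).
have := ler_wpM2r (enorm_ge0 (t *: d)) Lip.
rewrite -(mulrA L (enorm _)) -expr2 sqr_enorm !dotv_lin; lra.
Qed.

(** A trial step t with C t <= 1 - beta is accepted, because 1 - C t >= beta and g.d <= 0. Hence a
    rejected step exceeds (1 - beta) / C, and the accepted one is either 1 or delta times a rejected
    one. *)
Lemma armijo_step_ge (R : realType) (n : nat) (f : 'cV[R]_n -> R)
    (g : 'cV[R]_n -> 'cV[R]_n) (delta beta C : R) (x d : 'cV[R]_n) (l : R) :
  0 < delta < 1 -> 0 < C -> beta < 1 -> dotv (g x) d <= 0 ->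
  (forall t, 0 <= t <= 1 ->
    f (x + t *: d) <= f x + t * dotv (g x) d - C * t ^+ 2 * dotv (g x) d) ->
  armijo_step f g delta beta x d l ->
  Num.min 1 (delta * ((1 - beta) / C)) <= l.
Proof.
move=> /andP[de0 de1] C0 b1 p0 fle [[|m] [-> _ fail]].
  by rewrite expr0 ge_min lexx.
rewrite ge_min exprS ler_pM2l//; apply/orP; right.
rewrite leNgt; apply/negP; rewrite ltr_pdivlMr// => tC.
apply: (fail m) => //; rewrite /armijo_cond.
have t0 : 0 < delta ^+ m by rewrite exprn_gt0.
have := fle (delta ^+ m).
rewrite (ltW t0) exprn_ile1 ?(ltW de0) ?(ltW de1)// => /(_ isT).
set t := delta ^+ m in tC t0 *; set p := dotv _ _ in p0 *.
have tp : t * p <= 0 by rewrite pmulr_rle0.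
nra.
Qed.

(* [w] stands for [x^(k) - x^*], [v] for the gradient and [S] for [D_k^-1]. *)
Lemma scaled_distance_step (R : realType) (n : nat) (S : 'M[R]_n)
    (a l : R) (v w d : 'cV[R]_n) :
  S^T = S -> 0 < a -> 0 <= l <= 1 -> 0 <= dotv d (S *m d) ->
  0 <= dotv v (- w - d) + a^-1 * dotv (- w - d) (S *m d) ->
  dotv (w + l *: d) (S *m (w + l *: d)) <=
  dotv w (S *m w) - 2 * l * a * dotv v w - 2 * l * a * dotv v d.
Proof.
move=> ST a0 /andP[l0 l1] dd opt.
have := mulr_ge0 (ltW a0) opt.
rewrite mulrDr mulrA divff ?gt_eqF// mul1r mulmxDr -scalemxAr !dotv_lin.
rewrite (dotv_sym d w ST).
set p := dotv v w; set q := dotv v d; set r := dotv w _; set s := dotv d _ in dd *.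
move=> /(mulr_ge0 l0); set T := dotv w _.
(* The variational inequality bounds the cross term 2 l w.Sd; what is left over is (l^2 - 2 l) d.Sd,
   nonpositive for l in [0, 1]. *)
have := mulr_ge0 (mulr_ge0 l0 dd) (_ : 0 <= 1 - l).
by rewrite subr_ge0 => /(_ l1); nra.
Qed.

(** * From the perturbed recursion to the 1/k rate *)

Lemma harmonic_rate_of_recursion (R : realType) (e V zeta : nat -> R) (c : R) :
  0 < c -> (forall k, 0 <= e k) -> (forall k, e k.+1 <= e k) ->
  (forall k, 0 <= V k) -> (forall k, 0 <= zeta k) -> cvgn (series zeta) ->
  (forall k, V k.+1 + c * e k <= (1 + zeta k) * V k) ->
  exists C : R, forall N, N%:R * e N <= C.
Proof.
move=> c0 e0 e_noninc V0 zeta0 zeta_cvg rec.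
have seriesS k : series zeta k.+1 = series zeta k + zeta k.
  by rewrite /series/= big_nat_recr.
have zetaZ k : series zeta k <= limn (series zeta).
  apply: nondecreasing_cvgn_le => //; apply/nondecreasing_seqP => i.
  by rewrite seriesS lerDl.
set Z := limn _ in zetaZ.
(* Since 1 + zeta <= exp zeta, the product of the growth factors is at most the exponential of the
   partial sum. *)
have VM k : V k <= V 0%N * expR Z.
  apply: (@le_trans _ _ (V 0%N * expR (series zeta k))); last first.
    by rewrite ler_wpM2l// ler_expR.
  elim: k => [|k IH]; first by rewrite /series/= big_geq// expR0 mulr1.
  rewrite seriesS expRD mulrA mulrC.
  apply: (@le_trans _ _ ((1 + zeta k) * V k)).
    by apply: le_trans (rec k); rewrite lerDl mulr_ge0// ltW.
  by apply: ler_pM => //; [rewrite addr_ge0|exact: expR_ge1Dx].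
set M := V 0%N * expR Z in VM.
(* With V bounded by M, the recursion reads V_(k+1) - V_k + c e_k <= M zeta_k and telescopes. *)
have sum_e N : V N + c * (\sum_(0 <= k < N) e k) <= V 0%N + M * series zeta N.
  elim: N => [|N IH]; first by rewrite /series/= !big_geq// !mulr0.
  rewrite seriesS big_nat_recr//=; have := rec N.
  by have := ler_wpM2l (zeta0 N) (VM N); lra.
have sum_ge N : N%:R * e N <= \sum_(0 <= k < N) e k.
  elim: N => [|N IH]; first by rewrite mul0r big_geq.
  rewrite big_nat_recr//= -natr1.
  have := ler_wpM2l (ler0n R N.+1) (e_noninc N); rewrite -natr1; lra.
exists ((V 0%N + M * Z) / c) => N; apply: le_trans (sum_ge N) _.
rewrite ler_pdivlMr// mulrC.
have M0 : 0 <= M by apply: le_trans (VM 0%N).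
have := sum_e N; have := V0 N; have := ler_wpM2l M0 (zetaZ N); lra.
Qed.

(** * Properties of the SGP iterates *)

Section sgp_iterates.
Context (R : realType) (n : nat) (Omega : set 'cV[R]_n)
  (f : 'cV[R]_n -> R) (g : 'cV[R]_n -> 'cV[R]_n)
  (alpha_min alpha_max mu delta beta : R)
  (alpha mu_ : nat -> R) (D : nat -> 'M[R]_n)
  (x y d : nat -> 'cV[R]_n) (lambda : nat -> R)
  (convex_Omega : convex_set Omega)
  (run : sgp Omega f g alpha_min alpha_max mu delta beta
           alpha mu_ D x y d lambda).

Lemma sgp_alpha_gt0 k : 0 < alpha k.
Proof.
have /andP[am0 _] := sgp_alpha_bounds run.
by have /andP[/(lt_le_trans am0)] := sgp_alpha run k.
Qed.

Lemma sgp_mu_gt0 k : 0 < mu_ k.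
Proof. by have /andP[/(lt_le_trans ltr01)] := sgp_mu_ run k. Qed.

Lemma sgp_lambda01 k : 0 < lambda k <= 1.
Proof.
have [m [-> _ _]] := sgp_lambda run k; have /andP[d0 d1] := sgp_delta run.
by rewrite exprn_gt0//= exprn_ile1 ?ltW.
Qed.

(** Feasibility of [x k] is assumed here because the induction in [sgp_in] relies on this lemma. *)
Lemma sgp_segment k t : Omega (x k) -> 0 <= t <= 1 -> Omega (x k + t *: d k).
Proof.
rewrite (sgp_d run) => xO t01; apply: convex_set_segment => //.
by have [] := sgp_y run k.
Qed.

Lemma sgp_in k : Omega (x k).
Proof.
elim: k => [|k IH]; first exact: sgp_x0 run.
rewrite (sgp_next run); apply: sgp_segment => //.
by have /andP[/ltW-> ->] := sgp_lambda01 k.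
Qed.

Lemma sgp_invmx k : (invmx (D k))^T = invmx (D k) /\
  forall v, (mu_ k)^-1 * dotv v v <= dotv v (invmx (D k) *m v) <= mu_ k * dotv v v.
Proof. by apply: scaling_mx_invmx; [exact: sgp_mu_gt0|exact: (sgp_D run)]. Qed.

Lemma sgp_optimality k z : Omega z ->
  0 <= dotv (g (x k)) (z - x k - d k) +
       (alpha k)^-1 * dotv (z - x k - d k) (invmx (D k) *m d k).
Proof.
move=> zO; have [ST _] := sgp_invmx k.
have := sgp_model_argmin convex_Omega ST (sgp_y run k) zO.
by rewrite (sgp_d run) opprB addrA subrK.
Qed.

(** Testing the variational inequality at z = x_k gives d.D^-1 d <= - alpha_k g.d, and |d|^2 <= mu_k
    d.D^-1 d. *)
Lemma sgp_descent_direction k :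
  dotv (g (x k)) (d k) <= 0 /\
  dotv (d k) (d k) <= mu * alpha_max * - dotv (g (x k)) (d k).
Proof.
have [ST /(_ (d k)) /andP[Sge _]] := sgp_invmx k.
have := sgp_optimality k (sgp_in k); rewrite subrr sub0r !dotv_lin.
have a0 := sgp_alpha_gt0 k; have m0 := sgp_mu_gt0 k.
move=> /(mulr_ge0 (ltW a0)); rewrite mulrDr mulrA divff ?gt_eqF// mul1r.
move: Sge; set s := dotv _ (_ *m _); set p := dotv (g _) _; set q := dotv _ _.
have q0 : 0 <= q := dotvv_ge0 _.
rewrite ler_pdivrMl// => qs sp.
have s0 : 0 <= s by rewrite -(pmulr_rge0 _ m0) (le_trans q0).
have p0 : p <= 0 by rewrite -(pmulr_rle0 _ a0); lra.
split=> //.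
have /andP[_ aM] := sgp_alpha run k; have /andP[_ mM] := sgp_mu_ run k.
apply: (le_trans qs); rewrite -mulrA; apply: ler_pM => //; first exact: ltW.
have := ler_wnM2r p0 aM; lra.
Qed.

Lemma sgp_armijo k :
  f (x k.+1) <= f (x k) + beta * lambda k * dotv (g (x k)) (d k).
Proof. by rewrite (sgp_next run); have [m [-> ? _]] := sgp_lambda run k. Qed.

Lemma sgp_decreasing k : f (x k.+1) <= f (x k).
Proof.
apply: (le_trans (sgp_armijo k)); rewrite gerDl pmulr_rle0.
  by have [] := sgp_descent_direction k.
have /andP[b0 _] := sgp_beta run; have /andP[l0 _] := sgp_lambda01 k.
by rewrite mulr_gt0.
Qed.

(* In the level-bounded case the iterates stay in a bounded level set, on which
   the gradient is bounded; the directions are then bounded as well, and a single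
   compact set contains all the segments tested by the linesearch. *)
Lemma sgp_segment_lipschitz : closed Omega ->
  globally_lipschitz Omega g \/
    (locally_lipschitz Omega g /\ level_bounded Omega f) ->
  exists2 L : R, 0 < L & forall k t, 0 <= t <= 1 ->
    enorm (g (x k + t *: d k) - g (x k)) <= L * enorm (t *: d k).
Proof.
move=> cO [[L Lip]|[Lip lev]].
  (* The given constant has no prescribed sign; this one is positive. *)
  exists (`|L| + 1) => [|k t t01]; first by rewrite ltr_wpDl.
  have := Lip _ _ (sgp_in k) (sgp_segment (sgp_in k) t01).
  rewrite addrAC subrr add0r => /le_trans; apply.
  by rewrite ler_wpM2r ?enorm_ge0// (le_trans (ler_norm _))// lerDl ler01.
pose box (M : R) := Omega `&` [set v : 'cV[R]_n | forall i, `|v i 0| <= M].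
have box_lipschitz (M : R) : exists2 L, 0 < L & forall u v, box M u -> box M v ->
    enorm (g v - g u) <= L * enorm (v - u).
  have [||L [L0 LipL]] := Lip (box M); last by exists L.
    apply: (subclosed_compact _ (@cV_compact R n M)) => [|v []//].
    apply: closedI => //; exact: compact_closed (@cV_compact R n M).
  by move=> v [].
have fx0 k : f (x k) <= f (x 0%N).
  by elim: k => // k; apply: le_trans; exact: sgp_decreasing.
have [B0 B0_ge0 xB0] : exists2 B0, 0 <= B0 & forall k i, `|x k i 0| <= B0.
  have [B [_ /(_ (`|B| + 1)) HB]] := lev (f (x 0%N)).
  exists (`|B| + 1) => [|k i]; first by rewrite addr_ge0.
  apply: le_trans (HB _ (x k) _).
  - by rewrite [leRHS]/Num.Def.normr/= mx_normrE; exact: (le_bigmax _ _ (i, 0)).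
  - by rewrite (le_lt_trans (ler_norm _))// ltrDl.
  - by split; [exact: sgp_in|exact: fx0].
have [L0 L0_gt0 LipL0] := box_lipschitz B0.
(* [G] bounds the gradient at all iterates: any [x k] is within n * 2 B0 of [x 0]. *)
pose G := L0 * (n%:R * (B0 + B0)) + enorm (g (x 0%N)).
(* From |d|^2 <= mu alpha_max (- g.d) <= mu alpha_max G |d|, divide by |d|; d = 0 is treated
   apart. *)
have dG k : enorm (d k) <= mu * alpha_max * G.
  have [p0 dp] := sgp_descent_direction k.
  have pG : - dotv (g (x k)) (d k) <= G * enorm (d k).
    have -> : g (x k) = (g (x k) - g (x 0%N)) + g (x 0%N) by rewrite subrK.
    rewrite dotvDl opprD mulrDl -!dotvNr; apply: lerD; last first.
      apply: le_trans (cauchy_schwarz _ _) _.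
      by rewrite {2}/enorm dotvNl dotvNr opprK.
    apply: le_trans (cauchy_schwarz _ _) _.
    rewrite {2}/enorm dotvNl dotvNr opprK ler_wpM2r ?enorm_ge0//.
    apply: (le_trans (LipL0 (x 0%N) (x k) _ _)).
    - by split=> //; exact: sgp_in.
    - by split=> //; exact: sgp_in.
    rewrite ler_pM2l// enorm_le_coord ?addr_ge0// => i.
    by rewrite !mxE (le_trans (ler_normB _ _))// lerD.
  have mua : 0 <= mu * alpha_max.
    have /andP[am0 amM] := sgp_alpha_bounds run.
    by rewrite mulr_ge0// ?(le_trans ler01 (sgp_mu run))// ltW// (lt_le_trans am0).
  have := le_trans dp (ler_wpM2l mua pG).
  rewrite -sqr_enorm expr2 mulrA.
  have [->|] := eqVneq (enorm (d k)) 0.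
    move=> _; apply: mulr_ge0 => //.
    by rewrite addr_ge0 ?enorm_ge0// !mulr_ge0 ?addr_ge0// ltW.
  by move=> d0; rewrite ler_pM2r// lt_neqAle eq_sym d0 enorm_ge0.
pose B1 := B0 + mu * alpha_max * G.
have [L1 L1_gt0 LipL1] := box_lipschitz B1.
exists L1 => // k t t01.
have inB1 s : 0 <= s <= 1 -> box B1 (x k + s *: d k).
  move=> /[dup] s01 /andP[s0 s1]; split; first by apply: sgp_segment => //; exact: sgp_in.
  move=> i; rewrite !mxE (le_trans (ler_normD _ _))// lerD// normrM ger0_norm//.
  apply: le_trans (dG k); apply: le_trans (coord_le_enorm _ i).
  by rewrite ler_piMl.
have -> : t *: d k = x k + t *: d k - x k by rewrite addrC addKr.
rewrite [X in g X](_ : _ = x k + t *: d k); last by rewrite addrC subrK.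
apply: LipL1; last exact: inB1.
by rewrite -[x k]addr0 -(scale0r (d k)); apply: inB1; rewrite lexx ler01.
Qed.

Lemma sgp_stepsize_bounded_below : closed Omega -> convex_on Omega f g ->
  globally_lipschitz Omega g \/
    (locally_lipschitz Omega g /\ level_bounded Omega f) ->
  exists2 l, 0 < l & forall k, l <= lambda k.
Proof.
move=> cO cf /(sgp_segment_lipschitz cO)[L L0 Lip].
have /andP[am0 amM] := sgp_alpha_bounds run.
have /andP[de0 de1] := sgp_delta run; have /andP[b0 b1] := sgp_beta run.
have mua : 0 < mu * alpha_max.
  by rewrite mulr_gt0// ?(lt_le_trans ltr01 (sgp_mu run))// (lt_le_trans am0).
(* Bounding |d|^2 by mu alpha_max (- g.d) turns the term L t^2 |d|^2 of the descent bound into - C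
   t^2 g.d. *)
pose C := L * (mu * alpha_max); have C0 : 0 < C by rewrite mulr_gt0.
exists (Num.min 1 (delta * ((1 - beta) / C))) => [|k].
  by rewrite lt_min ltr01 mulr_gt0// divr_gt0// subr_gt0.
have [p0 dp] := sgp_descent_direction k.
apply: armijo_step_ge (sgp_lambda run k) => // [|t t01]; first exact: sgp_delta run.
have := convex_on_descent cf (sgp_in k) (sgp_segment (sgp_in k) t01) _ (Lip k t t01).
have /andP[t0 _] := t01 => /(_ t0) /le_trans; apply.
by have := ler_wpM2l (mulr_ge0 (ltW L0) (sqr_ge0 t)) dp; rewrite /C; lra.
Qed.

(** Passing from the D_k^-1 norm to the Euclidean one costs a factor mu_k on each side, hence the
    coefficient mu_k^2. *)
Lemma sgp_recursion lmin z k : convex_on Omega f g -> 0 < lmin ->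
  lmin <= lambda k -> Omega z -> f z <= f (x k) ->
  dotv (x k.+1 - z) (x k.+1 - z) + 2 * lmin * alpha_min * (f (x k) - f z) <=
  mu_ k ^+ 2 * dotv (x k - z) (x k - z) +
    mu * (2 * alpha_max / beta) * (f (x k) - f (x k.+1)).
Proof.
move=> cf l0 lmin_le zO fz.
have [ST Sbd] := sgp_invmx k.
have a0 := sgp_alpha_gt0 k; have m0 := sgp_mu_gt0 k.
have /andP[lk0 lk1] := sgp_lambda01 k.
have [p0 _] := sgp_descent_direction k.
have := @scaled_distance_step R n (invmx (D k)) (alpha k) (lambda k) (g (x k))
  (x k - z) (d k) ST a0 _ _ _.
rewrite (ltW lk0) lk1 opprB => /(_ isT).
have dd : 0 <= dotv (d k) (invmx (D k) *m d k).
  have /andP[+ _] := Sbd (d k); apply: le_trans.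
  by rewrite mulr_ge0 ?dotvv_ge0// invr_ge0 ltW.
move=> /(_ dd (sgp_optimality k zO)).
rewrite [x k - z + _]addrAC -(sgp_next run).
have /andP[+ _] := Sbd (x k.+1 - z); have /andP[_ +] := Sbd (x k - z).
rewrite ler_pdivrMl//.
set T := dotv _ (invmx _ *m _); set T' := dotv _ (invmx _ *m _).
set E := dotv (x k - z) _; set E' := dotv (x k.+1 - z) _.
move=> TE E'T' T'T.
have /andP[am0 amM] := sgp_alpha_bounds run.
have /andP[b0 _] := sgp_beta run.
have /andP[amk akM] := sgp_alpha run k.
have /andP[m1 mM] := sgp_mu_ run k.
have gz : f (x k) - f z <= dotv (g (x k)) (x k - z).
  by have := cf _ _ (sgp_in k) zO; rewrite -[z - _]opprB dotvNr; lra.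
set u := dotv (g (x k)) (x k - z) in T'T gz; set p := dotv (g _) (d k) in T'T p0.
set e := f (x k) - f z in gz *.
have e0 : 0 <= e by rewrite subr_ge0.
have cu : 2 * lmin * alpha_min * e <= 2 * lambda k * alpha k * u.
  have l2 : 0 <= 2 * lmin * alpha_min by rewrite !mulr_ge0// ltW.
  apply: ler_pM => //; apply: ler_pM => //; [by rewrite mulr_ge0// ltW|exact: ltW|].
  by rewrite ler_pM2l.
(* This term has the unfavourable sign; the Armijo decrease pays for it, at the price of 1 /
   beta. *)
have cp : - (2 * lambda k * alpha k * p) <=
    2 * alpha_max / beta * (f (x k) - f (x k.+1)).
  have arm : lambda k * - p <= (f (x k) - f (x k.+1)) / beta.
    by rewrite ler_pdivlMr//; have := sgp_armijo k; rewrite -/p; lra.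
  have lp : 0 <= lambda k * - p by rewrite mulr_ge0 ?oppr_ge0// ltW.
  have := ler_pM (ltW a0) lp akM arm.
  rewrite mulrCA mulrA; lra.
have df : 0 <= 2 * alpha_max / beta * (f (x k) - f (x k.+1)).
  rewrite mulr_ge0 ?subr_ge0 ?sgp_decreasing// divr_ge0 ?(ltW b0)// mulr_ge0//.
  by rewrite ltW// (lt_le_trans am0).
have ce : 0 <= 2 * lmin * alpha_min * e by rewrite !mulr_ge0// ltW.
rewrite -[mu * _ * _]mulrA.
move: cu cp df ce.
set A := 2 * lmin * alpha_min * e; set Q := 2 * alpha_max / beta * _.
move=> cu cp df ce.
have T'le : T' <= mu_ k * E - A + Q by lra.
(* After multiplication by mu_k, use mu_k >= 1 on the gain [A] and mu_k <= mu on the loss [Q]. *)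
have := ler_wpM2l (ltW m0) T'le.
have := ler_wpM2r df mM; have := ler_wpM2r ce m1; lra.
Qed.

End sgp_iterates.

(** * Assembly of the convergence rate *)

Unset Implicit Arguments.

Theorem theorem3p2 (R : realType) (n : nat) (Omega : set 'cV[R]_n)
    (f : 'cV[R]_n -> R) (grad_f : 'cV[R]_n -> 'cV[R]_n)
    (alpha_min alpha_max mu delta beta : R)
    (alpha mu_ zeta : nat -> R) (D : nat -> 'M[R]_n)
    (x y d : nat -> 'cV[R]_n) (lambda : nat -> R)
    (closed_Omega : closed Omega)
    (convex_Omega : convex_set Omega)
    (C1_f : C1_on Omega f grad_f)
    (convex_f : convex_on Omega f grad_f)
    (solvable : argmin_on Omega f !=set0)
    (sgp_x : sgp Omega f grad_f alpha_min alpha_max mu delta beta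
               alpha mu_ D x y d lambda)
    (mu_zeta : forall k, mu_ k ^+ 2 = 1 + zeta k)
    (zeta_ge0 : forall k, 0 <= zeta k)
    (zeta_summable : cvgn (series zeta))
    (lipschitz_or_level_bounded :
       globally_lipschitz Omega grad_f \/
       (locally_lipschitz Omega grad_f /\ level_bounded Omega f)) :
  (fun k : nat => f (x k) - optimal_value Omega f)
    =O_\oo (fun k : nat => (k%:R : R)^-1).
Proof.
have [z [zO zmin]] := solvable.
have zopt : optimal_value Omega f = f z.
  apply/le_anti/andP; split.
    apply: ge_inf; last by exists z.
    by exists (f z) => _ [w wO <-]; exact: zmin.
  by apply: lb_le_inf; [exists (f z), z|move=> _ [w wO <-]; exact: zmin].
have [lmin lmin0 lminP] :=
  sgp_stepsize_bounded_below convex_Omega sgp_x closed_Omega convex_f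
    lipschitz_or_level_bounded.
have /andP[am0 amM] := sgp_alpha_bounds sgp_x.
have /andP[b0 _] := sgp_beta sgp_x.
have mu0 : 0 < mu := lt_le_trans ltr01 (sgp_mu sgp_x).
pose e k := f (x k) - f z.
have e0 k : 0 <= e k by rewrite subr_ge0 zmin//; exact: (sgp_in convex_Omega sgp_x).
(* The coefficient of f(x_k) - f(x_(k+1)) in [sgp_recursion]: adding A e_k to the squared distance
   absorbs that difference. *)
pose A := mu * (2 * alpha_max / beta).
have A0 : 0 <= A.
  by rewrite mulr_ge0 ?divr_ge0 ?mulr_ge0// ltW// (lt_le_trans am0).
have [|k|k|k|C eC] := @harmonic_rate_of_recursion R e
    (fun k => dotv (x k - z) (x k - z) + A * e k) zeta
    (2 * lmin * alpha_min) _ e0 _ _ zeta_ge0 zeta_summable.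
- by rewrite !mulr_gt0.
- by rewrite lerD2r (sgp_decreasing convex_Omega sgp_x).
- by rewrite addr_ge0 ?dotvv_ge0// mulr_ge0.
- have fz : f z <= f (x k) by have := e0 k; rewrite subr_ge0.
  have := sgp_recursion convex_Omega sgp_x convex_f lmin0 (lminP k) zO fz.
  rewrite mu_zeta -/A -/(e k).
  have -> : f (x k) - f (x k.+1) = e k - e k.+1 by rewrite /e; lra.
  (* Only the squared distance is inflated by 1 + zeta_k; adding zeta_k A e_k >= 0 completes the
     factor on all of V_k. *)
  have := mulr_ge0 (zeta_ge0 k) (mulr_ge0 A0 (e0 k)); lra.
apply/eqO_exP; exists (`|C| + 1); first by rewrite ltr_wpDl.
near=> N.
rewrite zopt -/(e N) ger0_norm// (ger0_norm (_ : 0 <= N%:R^-1)) ?invr_ge0//.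
(* Restricting to N > 0 avoids the convention that the inverse of 0 is 0. *)
rewrite ler_pdivlMr ?ltr0n; last by near: N; exact: nbhs_infty_gt.
by rewrite mulrC (le_trans (eC N))// (le_trans (ler_norm _))// lerDl.
Unshelve. all: by end_near.
Qed.
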